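(* Let $A$ and $A'$ be finite dimensional associative (not necessarily unital) $\mathbb C$-algebras with distinguished bases $B$ and $B'$, respectively, and let $f\colon A\to A'$ be a $\mathbb C$-algebra homomorphism. Let $P$ be the $B'\times B$ matrix of $f$ with respect to the bases $B$ and $B'$, that is, $f(b)=\sum_{b'\in B'}P_{b',b}\,b'$ for $b\in B$. Let $\widetilde f\colon\mathbb C[X_B]\to\mathbb C[X_{B'}]$ be the $\mathbb C$-algebra homomorphism with $\widetilde f(x_b)=\sum_{b'\in B'}P_{b',b}\,x_{b'}$ for $b\in B$. Then $$\widetilde f(C(A,B))=P^TC(A',B')P,$$ where $\widetilde f$ is applied entrywise to the matrix $C(A,B)$. Therefore, if $f$ is an isomorphism, then $$\theta_{(A,B)}=\det(P)^2\,\widetilde f^{-1}(\theta_{(A',B')}).$$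
   Context: For a finite dimensional algebra $A$ with basis $B$, structure constants $c_{b'',b_1,b_2}\in\mathbb C$ are defined by $b_1b_2=\sum_{b''\in B}c_{b'',b_1,b_2}b''$ for $b_1,b_2\in B$. Let $X_B=\{x_b\mid b\in B\}$ be a set of variables in bijection with $B$. The Cayley table $C(A,B)$ is the $B\times B$ matrix over $\mathbb C[X_B]$ with $C(A,B)_{b_1,b_2}=\sum_{b''\in B}c_{b'',b_1,b_2}x_{b''}$, and the paratrophic determinant is $\theta_{(A,B)}=\det C(A,B)$. When $f$ is an isomorphism, $\det(P)^2$ is computed by identifying the index sets $B$ and $B'$ by any bijection; the square does not depend on the choice. *)

(* Defs.v *)
From HB Require Import structures.
From mathcomp Require Import all_boot all_order all_algebra.
From mathcomp Require Import reals complex mpoly.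

Set Implicit Arguments.
Unset Strict Implicit.
Unset Printing Implicit Defensive.

Import GRing.Theory.
Local Open Scope ring_scope.

(* The ring structures are all unital, so a finite dimensional non-unital     *)
(* algebra is a finite dimensional vector space (vectType) with an            *)
(* associative bilinear product mul. A distinguished basis is an n-tuple B    *)
(* with basis_of fullv B, and B-indexed variables, rows and columns are       *)
(* indexed by 'I_n.                                                           *)

Section Paratrophic.
Variable F : fieldType.

Definition structure_const (A : vectType F) (mul : {bilinear A -> A -> A})
    (n : nat) (B : n.-tuple A) (k i j : 'I_n) : F :=
  coord B k (mul B`_i B`_j).

Definition cayley_table (A : vectType F) (mul : {bilinear A -> A -> A})
    (n : nat) (B : n.-tuple A) : 'M[{mpoly F[n]}]_n :=
  \matrix_(i < n, j < n) \sum_(k < n) structure_const mul B k i j *: 'X_k.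

Definition paratrophic_det (A : vectType F) (mul : {bilinear A -> A -> A})
    (n : nat) (B : n.-tuple A) : {mpoly F[n]} :=
  \det (cayley_table mul B).

(* Column j holds the coordinates of f B_j in B', so this acts on column      *)
(* vectors (it is the transpose of the library's row-vector convention).      *)
Definition hom_matrix (A A' : vectType F) (n m : nat)
    (B : n.-tuple A) (B' : m.-tuple A') (f : {linear A -> A'}) : 'M[F]_(m, n) :=
  \matrix_(i < m, j < n) coord B' i (f B`_j).

Definition linear_subst (n m : nat) (P : 'M[F]_(m, n))
    (p : {mpoly F[n]}) : {mpoly F[m]} :=
  p \mPo [tuple \sum_(k < m) P k i *: 'X_k | i < n].

Lemma structure_constP (A : vectType F) (mul : {bilinear A -> A -> A})
    (n : nat) (B : n.-tuple A) (i j : 'I_n) :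
  basis_of fullv B ->
  mul B`_i B`_j = \sum_(k < n) structure_const mul B k i j *: B`_k.
Proof. by move=> BP; exact: (coord_basis BP (memvf _)). Qed.

Lemma hom_matrixP (A A' : vectType F) (n m : nat)
    (B : n.-tuple A) (B' : m.-tuple A') (f : {linear A -> A'}) (j : 'I_n) :
  basis_of fullv B' ->
  f B`_j = \sum_(i < m) hom_matrix B B' f i j *: B'`_i.
Proof.
move=> BP'; have := coord_basis BP' (memvf (f B`_j)) => {1}->.
by apply: eq_bigr => i _; rewrite mxE.
Qed.

Lemma linear_substX (n m : nat) (P : 'M[F]_(m, n)) (i : 'I_n) :
  linear_subst P 'X_i = \sum_(k < m) P k i *: 'X_k.
Proof. by rewrite /linear_subst comp_mpolyXU -tnth_nth tnth_mktuple. Qed.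

End Paratrophic.

(* Main.v *)
(* Each v in A gives the linear form of its coordinates, in the variables     *)
(* X_B. The entry (i, j) of the Cayley table is the linear form of B_i B_j,   *)
(* and the substitution attached to f sends the linear form of v to that of   *)
(* f v. Since f (B_i B_j) = (f B_i) (f B_j), bilinearity gives the matrix     *)
(* identity. Composition of maps corresponds to composition of substitutions, *)
(* so an isomorphism has an invertible substitution, and the second identity  *)
(* follows by taking determinants.                                            *)

Require Import Defs.
From HB Require Import structures.
From mathcomp Require Import all_boot all_order perm all_algebra.
From mathcomp Require Import reals complex mpoly.

Set Implicit Arguments.
Unset Strict Implicit.
Unset Printing Implicit Defensive.

Import GRing.Theory.
Local Open Scope ring_scope.

(** The link between the algebras and the polynomial rings is [coord_form]:
    [linear_subst_coord_form] says that taking linear forms intertwines [f] with its substitution,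
    and [map_cayley_table] is this applied to products of basis vectors. For an isomorphism, the
    inverse map has the inverse matrix ([hom_matrix_can]), so [linear_substK] inverts the
    substitution; determinants then give the second identity, with [det_rowsub_bij_sqr] making the
    square independent of how the index sets are identified. *)

Section LinearSubst.
Variable F : fieldType.

HB.instance Definition _ (n m : nat) (P : 'M[F]_(m, n)) :=
  GRing.LRMorphism.copy (linear_subst P)
    (comp_mpoly [tuple \sum_(k < m) P k i *: 'X_k | i < n]).

Lemma mpoly_lrmorphism_id (n : nat)
    (g : {lrmorphism {mpoly F[n]} -> {mpoly F[n]}}) :
  (forall i, g 'X_i = 'X_i) -> g =1 id.
Proof.
move=> gX p; rewrite [p in LHS]mpolyE linear_sum [RHS]mpolyE.
apply: eq_bigr => u _; rewrite linearZ /= mpolyXE_id rmorph_prod /=.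
by congr (_ *: _); apply: eq_bigr => i _; rewrite rmorphXn /= gX.
Qed.

(** The composite is an algebra endomorphism, hence determined by the variables, and it sends ['X_i]
    to the linear form given by column [i] of [Q *m P]. *)
Lemma linear_substK (n m : nat) (P : 'M[F]_(m, n)) (Q : 'M[F]_(n, m)) :
  Q *m P = 1%:M -> cancel (linear_subst P) (linear_subst Q).
Proof.
move=> QP p.
apply: (mpoly_lrmorphism_id (g := linear_subst Q \o linear_subst P)) => i /=.
rewrite linear_substX linear_sum /=.
under eq_bigr do rewrite linearZ /= linear_substX scaler_sumr.
rewrite exchange_big (bigD1 i) //= [X in _ + X]big1 => [|l li].
  under eq_bigr do rewrite scalerA mulrC.
  have /matrixP/(_ i i) := QP; rewrite !mxE eqxx -scaler_suml => ->.
  by rewrite scale1r addr0.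
under eq_bigr do rewrite scalerA mulrC.
have /matrixP/(_ l i) := QP; rewrite !mxE (negbTE li) -scaler_suml => ->.
by rewrite scale0r.
Qed.

Definition coord_form (A : vectType F) (n : nat) (B : n.-tuple A) (v : A) :
    {mpoly F[n]} :=
  \sum_(k < n) coord B k v *: 'X_k.

Lemma coord_form_is_linear (A : vectType F) (n : nat) (B : n.-tuple A) :
  linear (coord_form B).
Proof.
move=> a u v; rewrite /coord_form scaler_sumr -big_split /=.
by apply: eq_bigr => k _; rewrite linearP scalerDl scalerA.
Qed.

HB.instance Definition _ (A : vectType F) (n : nat) (B : n.-tuple A) :=
  GRing.isLinear.Build F A {mpoly F[n]} _ (coord_form B)
    (coord_form_is_linear B).

Lemma cayley_tableE (A : vectType F) (mul : {bilinear A -> A -> A})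
    (n : nat) (B : n.-tuple A) (i j : 'I_n) :
  cayley_table mul B i j = coord_form B (mul B`_i B`_j).
Proof. by rewrite mxE. Qed.

Section HomMatrix.
Variables (A A' : vectType F) (n m : nat) (B : n.-tuple A) (B' : m.-tuple A').
Hypotheses (basisB : basis_of fullv B) (basisB' : basis_of fullv B').

(** Both sides are linear in [v], and on a basis vector both are the form given by a column of the
    matrix of [f]. *)
Lemma linear_subst_coord_form (f : {linear A -> A'}) (v : A) :
  linear_subst (hom_matrix B B' f) (coord_form B v) = coord_form B' (f v).
Proof.
rewrite [v in RHS](coord_basis basisB (memvf v)) /coord_form !linear_sum /=.
under [RHS]eq_bigr do rewrite linear_sum scaler_suml.
rewrite [RHS]exchange_big /=; apply: eq_bigr => k _.
rewrite linearZ /= linear_substX scaler_sumr; apply: eq_bigr => l _.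
by rewrite mxE [f (_ *: _)]linearZ [coord B' l (_ *: _)]linearZ /= scalerA.
Qed.

Lemma map_cayley_table (f : {linear A -> A'})
    (mul : {bilinear A -> A -> A}) (mul' : {bilinear A' -> A' -> A'}) :
  {morph f : x y / mul x y >-> mul' x y} ->
  let P := hom_matrix B B' f in
  let PX : 'M[{mpoly F[m]}]_(m, n) := map_mx (@mpolyC m F) P in
  map_mx (linear_subst P) (cayley_table mul B) =
    PX^T *m cayley_table mul' B' *m PX.
Proof.
move=> fM P PX; apply/matrixP => i j.
rewrite [LHS]mxE cayley_tableE linear_subst_coord_form fM.
(* The right factor is expanded first, to match the outer sum of [(PX^T *m _) *m PX]. *)
rewrite !(hom_matrixP B f _ basisB') linear_sumr linear_sum [RHS]mxE /=.
apply: eq_bigr => b _; rewrite linearZr linearZ /=.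
rewrite [PX b j]mxE [RHS]mulrC mul_mpolyC [(PX^T *m _) i b]mxE.
congr (_ *: _); rewrite linear_sumlz linear_sum.
apply: eq_bigr => a _; rewrite linearZl_LR linearZ /= -cayley_tableE.
by rewrite [PX^T i a]mxE [PX a i]mxE mul_mpolyC.
Qed.

Lemma hom_matrix_can (f : {linear A -> A'}) (g : {linear A' -> A}) :
  cancel f g -> hom_matrix B' B g *m hom_matrix B B' f = 1%:M.
Proof.
move=> fK; apply/matrixP => i j; rewrite !mxE.
(* The Kronecker delta is the [i]-th coordinate of [B_j], which is rewritten as [g (f B_j)]. *)
rewrite eq_sym -(coord_free j i (basis_free basisB)) -[in RHS](fK B`_j).
rewrite [in RHS](hom_matrixP B f j basisB') !linear_sum /=.
by apply: eq_bigr => k _; rewrite !linearZ mulrC [X in _ * X]mxE.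
Qed.

End HomMatrix.

(** Relabelling rows multiplies the determinant by a sign, which squaring removes. *)
Lemma det_rowsub_bij_sqr (n : nat) (e : 'I_n -> 'I_n) (P : 'M[F]_n) :
  bijective e -> \det (rowsub e P) ^+ 2 = \det P ^+ 2.
Proof.
move=> /bij_inj e_inj; have -> : rowsub e P = row_perm (perm e_inj) P.
  by apply/matrixP => i j; rewrite !mxE permE.
by rewrite row_permE det_mulmx det_perm exprMn sqrr_sign mul1r.
Qed.

Lemma linear_subst_paratrophic_det (A A' : vectType F) (n : nat)
    (B : n.-tuple A) (B' : n.-tuple A')
    (mul : {bilinear A -> A -> A}) (mul' : {bilinear A' -> A' -> A'})
    (f : {linear A -> A'}) :
  basis_of fullv B -> basis_of fullv B' ->
  {morph f : x y / mul x y >-> mul' x y} ->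
  linear_subst (hom_matrix B B' f) (paratrophic_det mul B) =
    \det (hom_matrix B B' f) ^+ 2 *: paratrophic_det mul' B'.
Proof.
move=> basisB basisB' fM; rewrite /paratrophic_det -det_map_mx.
rewrite (map_cayley_table basisB basisB' fM) !det_mulmx det_tr det_map_mx /=.
by rewrite mulrAC -expr2 -rmorphXn /= mul_mpolyC.
Qed.

Lemma paratrophic_det_iso (A A' : vectType F) (n m : nat)
    (B : n.-tuple A) (B' : m.-tuple A')
    (mul : {bilinear A -> A -> A}) (mul' : {bilinear A' -> A' -> A'})
    (f : {linear A -> A'}) (e : 'I_n -> 'I_m)
    (phi : {mpoly F[m]} -> {mpoly F[n]}) :
  basis_of fullv B -> basis_of fullv B' ->
  {morph f : x y / mul x y >-> mul' x y} -> n = m -> bijective e ->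
  let P := hom_matrix B B' f in
  cancel (linear_subst P) phi -> cancel phi (linear_subst P) ->
  paratrophic_det mul B =
    \det (rowsub e P) ^+ 2 *: phi (paratrophic_det mul' B').
Proof.
move=> basisB basisB' fM eq_nm.
(* Identifying [m] with [n] makes [P] square, so that [\det P] is well typed. *)
case: m / eq_nm in B' basisB' e phi * => e_bij P phiK phiK'.
(* [phi] is a bare function, so the scalar is moved through the linear map [linear_subst P]
   instead. *)
apply: (can_inj phiK); rewrite det_rowsub_bij_sqr // [RHS]linearZ /=.
by rewrite (linear_subst_paratrophic_det basisB basisB' fM) phiK'.
Qed.

End LinearSubst.

Theorem theorem2p6 (R : realType) (A A' : vectType R[i])
    (mul : {bilinear A -> A -> A}) (mul' : {bilinear A' -> A' -> A'})
    (mulA : associative mul) (mulA' : associative mul')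
    (n m : nat) (B : n.-tuple A) (B' : m.-tuple A')
    (basisB : basis_of fullv B) (basisB' : basis_of fullv B')
    (f : {linear A -> A'}) (fM : {morph f : x y / mul x y >-> mul' x y}) :
  let P := hom_matrix B B' f in
  let PX : 'M[{mpoly R[i][m]}]_(m, n) := map_mx (@mpolyC m R[i]) P in
  let ftilde := linear_subst P in
  map_mx ftilde (cayley_table mul B) = PX^T *m cayley_table mul' B' *m PX
  /\ (bijective f ->
      [/\ n = m, bijective ftilde &
          forall (e : 'I_n -> 'I_m) (ftilde_inv : {mpoly R[i][m]} -> {mpoly R[i][n]}),
            bijective e -> cancel ftilde ftilde_inv -> cancel ftilde_inv ftilde ->
            paratrophic_det mul B =
              (\det (rowsub e P)) ^+ 2 *: ftilde_inv (paratrophic_det mul' B')]).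
Proof.
move=> P PX ftilde; have tableE := map_cayley_table basisB basisB' fM.
split=> // -[g fK gK].
pose gL := GRing.isLinear.Build _ _ _ _ g (can2_linear fK gK).
pose G : {linear A' -> A} := HB.pack g gL.
have QP := hom_matrix_can (g := G) basisB basisB' fK.
have PQ := hom_matrix_can (f := G) basisB' basisB gK.
(* A factorization of an identity matrix bounds its size by the inner dimension; [QP] and [PQ] give
   the two inequalities. *)
have eq_nm : n = m.
  by apply/eqP; rewrite eqn_leq (mulmx1_min QP) (mulmx1_min PQ).
split=> //.
  by exists (linear_subst (hom_matrix B' B G)); apply: linear_substK.
move=> e ftilde_inv e_bij ftildeK ftilde_invK.
exact: (paratrophic_det_iso basisB basisB' fM eq_nm e_bij).
Qed.
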